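(* Let $i\ge0$ and $n=2^i+1$, and let $G_n=G_n(g,tg)$ be io-decomposable. Then $G_n$ and $G_{n+1}=G_{n+1}(g,tg)$ each have at least one universal vertex, namely the vertex $2^i+1$.
   Context: Power series have coefficients in $\mathbb{Z}$ (or $\mathbb{Z}_2$); $\equiv$ means congruence mod $2$; $[t^k]u$ is the coefficient of $t^k$ in $u$. For $f(0)=0$, the Riordan graph $G_n(g,f)$ is the simple graph on $[n]=\{1,\dots,n\}$ in which, for $i>j\ge1$, $i$ and $j$ are adjacent iff $[t^{i-2}]\,g f^{\,j-1}\equiv 1$. It is proper if $g(0)\equiv f'(0)\equiv1$. A vertex is universal if it is adjacent to all other vertices. A proper Riordan graph $G_n(g,f)$, with odd vertex set $V_o$ and even vertex set $V_e$, is io-decomposable if the induced subgraph $\langle V_o\rangle\cong G_{\lceil n/2\rceil}(g,f)$ via the relabeling $2k-1\mapsto k$ and the induced subgraph $\langle V_e\rangle$ is a null graph (no edges). *)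

(* Defs.v *)
From mathcomp Require Import all_boot all_order all_algebra.

Set Implicit Arguments.
Unset Strict Implicit.
Unset Printing Implicit Defensive.

Import GRing.Theory.

(* Formal power series with integer coefficients; [u k] is [t^k] u.  A series
   over Z/2 is represented by any integer lift: only parities matter below. *)
Definition fps : Type := nat -> int.

Definition fps_one : fps := fun k => ((k == 0%N)%:R)%R.

(* The indeterminate t. *)
Definition fps_t : fps := fun k => ((k == 1%N)%:R)%R.

Definition fps_mul (u v : fps) : fps :=
  fun k => (\sum_(j < k.+1) u j * v (k - j)%N)%R.

Definition fps_exp (u : fps) (m : nat) : fps := iter m (fps_mul u) fps_one.

Definition fps_deriv (u : fps) : fps := fun k => (u k.+1 *+ k.+1)%R.

Definition odd_coef (u : fps) (k : nat) : bool := (u k == 1 %[mod 2])%Z.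

(* The vertex set [n] = {1, ..., n} is 'I_n; the element with value v is the
   vertex v + 1. *)
Definition label (n : nat) (v : 'I_n) : nat := v.+1.

(* [i - 2] is truncated, but i > j >= 1 forces i >= 2. *)
Definition riordan_edge (g f : fps) (i j : nat) : bool :=
  [&& 1 <= j, j < i & odd_coef (fps_mul g (fps_exp f (j - 1))) (i - 2)].

Definition riordan_graph (n : nat) (g f : fps) : rel 'I_n :=
  fun u v => riordan_edge g f (label u) (label v)
          || riordan_edge g f (label v) (label u).

Lemma riordan_graph_sym (n : nat) (g f : fps) : symmetric (@riordan_graph n g f).
Proof. by move=> u v; rewrite /riordan_graph orbC. Qed.

Lemma riordan_graph_irrefl (n : nat) (g f : fps) :
  irreflexive (@riordan_graph n g f).
Proof. by move=> u; rewrite /riordan_graph /riordan_edge ltnn andbF. Qed.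

(* The first conjunct, f(0) = 0, is required for any Riordan graph. *)
Definition proper_riordan (g f : fps) : Prop :=
  [/\ f 0%N = 0%R, odd_coef g 0 & odd_coef (fps_deriv f) 0].

Definition universal (n : nat) (e : rel 'I_n) (v : 'I_n) : Prop :=
  forall u : 'I_n, u != v -> e v u.

Definition odd_vertices (n : nat) : {set 'I_n} := [set v | odd (label v)].
Definition even_vertices (n : nat) : {set 'I_n} := [set v | ~~ odd (label v)].

(* phi restricts to an isomorphism from the subgraph of e induced by V onto e';
   its values outside V are irrelevant. *)
Definition induced_iso (n m : nat) (e : rel 'I_n) (V : {set 'I_n})
    (e' : rel 'I_m) (phi : 'I_n -> 'I_m) : Prop :=
  [/\ {in V &, injective phi},
      phi @: V = [set: 'I_m]
    & {in V &, forall u v, e' (phi u) (phi v) = e u v}].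

Definition induced_null (n : nat) (e : rel 'I_n) (V : {set 'I_n}) : Prop :=
  {in V &, forall u v, ~~ e u v}.

(* [uphalf n] is the ceiling of n / 2. *)
Definition io_decomposable (n : nat) (g f : fps) : Prop :=
  [/\ proper_riordan g f,
      exists phi : 'I_n -> 'I_(uphalf n),
        {in odd_vertices n, forall v, label v = 2 * label (phi v) - 1} /\
        induced_iso (@riordan_graph n g f) (odd_vertices n)
          (@riordan_graph (uphalf n) g f) phi
    & induced_null (@riordan_graph n g f) (even_vertices n)].

(* Main.v *)
Require Import Defs.
From mathcomp Require Import all_boot all_order all_algebra.
From mathcomp Require Import zify.

(** Only the parities of finitely many coefficients of [g] matter, so [g] is
    replaced by a polynomial [p] over the field with two elements that
    truncates it.  For [f = t g]
    and [i > j >= 1] the adjacency coefficient [t^(i-2)] g (t g)^(j-1) equals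
    [t^(i-1-j)] g^j, so that vertex [2^i + 1] is adjacent to [j <= 2^i] iff
    [t^(2^i - j)] g^j is odd; its adjacency to [2^i + 2] only says that
    [g(0)^(2^i + 1)] is odd.

    The relabeling [2k-1 |-> k], applied to the edges at vertex 1, yields
    [t^(2k+1)] g = [t^k] g whenever [2k+1 < 2^i]: up to that order, [g] is the
    series of its own odd coefficients.  Together with the Frobenius identity
    [p^2 = p(t^2)] this lets one halve [j]:
    - if [j = 2v], then [t^(2(2^i - v))] p^(2v) = [t^(2^i - v)] p^v;
    - if [j = 2v + 1], then [p^j = p * p^v(t^2)], whose odd coefficients are
      those of (odd part of [p]) * [p^v], that is of [p * p^v = p^(v+1)] as
      far as the self-similarity reaches.
    Both cases descend from [2^(i+1)] to [2^i] ([coef_exp_pow2]), until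
    [j = 1 = 2^0], where the coefficient is [g(0)], odd by properness. *)

Set Implicit Arguments.
Unset Strict Implicit.
Unset Printing Implicit Defensive.

Import GRing.Theory.
Local Open Scope ring_scope.

(** * Powers of a polynomial over the field with two elements *)

Lemma Fp2_sqr (c : 'F_2) : c ^+ 2 = c.
Proof. by case: c => [[|[|m]]] // ?; apply/val_inj. Qed.

(** The Frobenius: cross terms are even, and squaring fixes the coefficients. *)
Lemma sqr_comp_polyXn (p : {poly 'F_2}) : p ^+ 2 = p \Po 'X^2.
Proof.
have char2 : 2%N \in [pchar {poly 'F_2}] by rewrite pchar_poly pchar_Fp.
elim/poly_ind: p => [|p c IHp]; first by rewrite comp_poly0 expr0n.
rewrite comp_polyD comp_polyM comp_polyX comp_polyC -IHp.
by rewrite sqrrD mulrn_pchar // addr0 exprMn -rmorphXn /= Fp2_sqr.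
Qed.

Lemma exp_double_comp (p : {poly 'F_2}) (v : nat) :
  p ^+ v.*2 = p ^+ v \Po 'X^2.
Proof. by rewrite -mul2n mulnC exprM sqr_comp_polyXn. Qed.

(** A series in [t^2] acts as a scalar on the splitting of [p] into even and
    odd part. *)
Lemma odd_polyM_comp (R : comNzRingType) (p q : {poly R}) :
  odd_poly (p * (q \Po 'X^2)) = odd_poly p * q.
Proof.
rewrite -{1}(poly_even_odd p) mulrDl mulrAC -!comp_polyM.
apply/polyP => k; rewrite coef_odd_poly coefD coefMX !coef_comp_poly_Xn //=.
by rewrite !dvdn2 /= odd_double /= add0r -muln2 mulnK.
Qed.

Lemma eq_coefMl (R : nzSemiRingType) (p p' q : {poly R}) (n : nat) :
  (forall k, (k <= n)%N -> p`_k = p'`_k) -> (p * q)`_n = (p' * q)`_n.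
Proof.
by move=> eq_p; rewrite !coefM; apply: eq_bigr => k _; rewrite eq_p // -ltnS.
Qed.

(** Descent from [2^(i+1)] to [2^i]: squaring handles even [j], and the
    self-similarity of [p] turns odd exponents [2v + 1] into [v + 1]. *)
Lemma coef_exp_pow2 (p : {poly 'F_2}) (i j : nat) :
  p`_0 = 1 ->
  (forall k, (k.*2.+1 < 2 ^ i)%N -> p`_k.*2.+1 = p`_k) ->
  (0 < j <= 2 ^ i)%N -> (p ^+ j)`_(2 ^ i - j) = 1.
Proof.
move=> p0; elim: i j => [|i IHi] j self_sim j_bnd.
  by have ->: j = 1%N by rewrite expn0 in j_bnd; lia.
have {}IHi v : (0 < v <= 2 ^ i)%N -> (p ^+ v)`_(2 ^ i - v) = 1.
  by apply: IHi => k lt_k; apply: self_sim; rewrite expnS; lia.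
move: self_sim j_bnd; rewrite expnS -(odd_double_half j) => self_sim.
set v := j./2; case: (odd j) => j_bnd; last first.
  rewrite add0n exp_double_comp coef_comp_poly_Xn // mul2n -doubleB.
  by rewrite dvdn2 odd_double /= -muln2 mulnK // IHi //; lia.
rewrite add1n exprS exp_double_comp.
have ->: (2 * 2 ^ i - v.*2.+1 = (2 ^ i - v.+1).*2.+1)%N by lia.
rewrite -coef_odd_poly odd_polyM_comp.
rewrite (@eq_coefMl _ _ p) => [|k le_k]; first by rewrite -exprS IHi //; lia.
by rewrite coef_odd_poly self_sim //; lia.
Qed.

(** * Truncating integer series to polynomials *)

(** A finite graph sees finitely many coefficients, so a series may be traded
    for a polynomial, where powers and the Frobenius are available.  The
    relation only looks below order [N], which makes it stable under products
    whatever the higher coefficients of [p] are. *)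
Definition truncates (R : nzRingType) (N : nat) (u : fps) (p : {poly R}) : Prop :=
  forall k, (k < N)%N -> p`_k = (u k)%:~R.

Section Truncation.

Variables (R : nzRingType) (N : nat).
Implicit Types (u v : fps) (p q : {poly R}).

Lemma truncates_poly u : truncates N u (\poly_(k < N) (u k)%:~R : {poly R}).
Proof. by move=> k lt_k; rewrite coef_poly lt_k. Qed.

Lemma truncates1 : truncates N fps_one (1 : {poly R}).
Proof. by move=> k _; rewrite coef1 /fps_one; case: eqP. Qed.

Lemma truncatesX : truncates N fps_t ('X : {poly R}).
Proof. by move=> k _; rewrite coefX /fps_t; case: eqP. Qed.

Lemma truncatesM u v p q :
  truncates N u p -> truncates N v q -> truncates N (fps_mul u v) (p * q).
Proof.
move=> up vq k lt_k; rewrite coefM rmorph_sum /=.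
apply: eq_bigr => j _; have le_jk := ltn_ord j.
by rewrite rmorphM /= up ?vq //; lia.
Qed.

Lemma truncates_exp u p (m : nat) :
  truncates N u p -> truncates N (fps_exp u m) (p ^+ m).
Proof.
move=> up; elim: m => [|m IHm]; first exact: truncates1.
by rewrite exprS; apply: truncatesM.
Qed.

End Truncation.

Lemma odd_coefE (u : fps) (k : nat) :
  odd_coef u k = ((u k)%:~R == 1 :> 'F_2).
Proof.
rewrite /odd_coef eqz_mod_dvd (dvdz_pcharf (@pchar_Fp 2 isT)).
by rewrite rmorphB subr_eq0.
Qed.

Lemma truncates_odd_coef (N : nat) (u : fps) (p : {poly 'F_2}) (k : nat) :
  truncates N u p -> (k < N)%N -> odd_coef u k = (p`_k == 1).
Proof. by move=> up lt_k; rewrite odd_coefE up. Qed.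

(** * Riordan graphs of the form G(g, tg) *)

(** With [f = t g], the factor [t^(j-1)] of [f^(j-1)] shifts the coefficient
    and the remaining factors merge into [g^j]. *)
Lemma riordan_edgeE (N : nat) (g : fps) (p : {poly 'F_2}) (i j : nat) :
  truncates N g p -> (0 < j < i)%N -> (i - 2 < N)%N ->
  riordan_edge g (fps_mul fps_t g) i j = ((p ^+ j)`_(i - j.+1) == 1).
Proof.
move=> gp /andP[j_gt0 lt_ji] lt_iN; rewrite /riordan_edge j_gt0 lt_ji /=.
have tgp := truncates_exp (j - 1) (truncatesM (@truncatesX _ N) gp).
rewrite (truncates_odd_coef (truncatesM gp tgp) lt_iN).
case: j j_gt0 lt_ji {tgp} => // j _ lt_ji; rewrite subn1 /=.
rewrite exprMn_comm; last exact: commr_sym (commr_polyX _).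
rewrite mulrCA -exprS coefXnM ifN; last by lia.
by congr (_`_ _ == _); lia.
Qed.

(** Vertex 1 is relabeled to itself and [2k+3] to [k+2]; the parities of
    [t^(2k+1)] g and [t^k] g decide their edges to vertex 1 in the graph and in
    the half-size one. *)
Lemma io_decomposable_self_similar (n : nat) (g : fps) (p : {poly 'F_2}) :
  truncates n g p -> io_decomposable n g (fps_mul fps_t g) ->
  forall k, (k.*2.+2 < n)%N -> p`_k.*2.+1 = p`_k.
Proof.
move=> gp [_ [phi [label_phi [_ _ phi_iso]]] _] k lt_k.
have n_gt0 : (0 < n)%N by lia.
pose a := Ordinal lt_k; pose b := Ordinal n_gt0.
have a_odd : a \in odd_vertices n by rewrite inE /label /= negbK odd_double.
have b_odd : b \in odd_vertices n by rewrite inE.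
have phi_a : label (phi a) = k.+2.
  by have := label_phi a a_odd; rewrite /label /=; lia.
have phi_b : label (phi b) = 1%N.
  by have := label_phi b b_odd; rewrite /label /=; lia.
have := phi_iso a b a_odd b_odd.
rewrite /riordan_graph phi_a phi_b /label /=.
(* the reversed edges go from a smaller to a larger label, hence are absent *)
rewrite [X in _ || X]/riordan_edge [X in _ = _ || X]/riordan_edge.
rewrite !ltnS !ltn0 !andbF !orbF !(riordan_edgeE gp); try lia.
rewrite !expr1 !subSS !subn0.
(* elements of a two-element field are equal once they agree on being 1 *)
by case: (p`_k) (p`_k.*2.+1) => [[|[|x]]] // ? [[|[|y]]] // ? ?; apply/val_inj.
Qed.

Local Close Scope ring_scope.

Theorem theorem4p13 (i n : nat) (g : fps) :
  n = 2 ^ i + 1 ->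
  io_decomposable n g (fps_mul fps_t g) ->
  (exists v : 'I_n,
     label v = 2 ^ i + 1 /\
     universal (@riordan_graph n g (fps_mul fps_t g)) v) /\
  (exists v : 'I_n.+1,
     label v = 2 ^ i + 1 /\
     universal (@riordan_graph n.+1 g (fps_mul fps_t g)) v).
Proof.
move=> def_n io_g; have [[_ g0 _] _ _] := io_g.
pose p := (\poly_(k < n) (g k)%:~R : {poly 'F_2})%R.
have gp : truncates n g p by apply: truncates_poly.
have p0 : (p`_0 = 1)%R by apply/eqP; rewrite -(truncates_odd_coef gp) //; lia.
have self_sim k : k.*2.+1 < 2 ^ i -> (p`_k.*2.+1 = p`_k)%R.
  by move=> lt_k; apply: (io_decomposable_self_similar gp io_g); lia.
have edge_below j :
    0 < j <= 2 ^ i -> riordan_edge g (fps_mul fps_t g) (2 ^ i + 1) j.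
  move=> j_bnd; rewrite (riordan_edgeE gp); try lia.
  by rewrite addn1 subSS coef_exp_pow2.
have edge_above : riordan_edge g (fps_mul fps_t g) (2 ^ i + 2) (2 ^ i + 1).
  rewrite (riordan_edgeE gp); try lia.
  by rewrite addn2 addn1 subnn -horner_coef0 horner_exp horner_coef0 p0 expr1n.
have lt_n : 2 ^ i < n by lia.
have lt_n1 : 2 ^ i < n.+1 by lia.
split; [exists (Ordinal lt_n) | exists (Ordinal lt_n1)];
  (split=> [|u ne_u]; first by rewrite /label /= addn1);
  rewrite /riordan_graph /label /= -(addn1 (2 ^ i)).
all: have {}ne_u : u != 2 ^ i :> nat by apply: contra ne_u => /eqP eq_u;
  apply/eqP/val_inj.
all: have lt_u := ltn_ord u.
  by rewrite edge_below //; lia.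
have [le_u|gt_u] := leqP u.+1 (2 ^ i); first by rewrite edge_below.
have ->: u.+1 = 2 ^ i + 2 by lia.
by rewrite edge_above orbT.
Qed.
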